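(* Let $\mathcal{I}(\mathcal{D},\mathcal{P},\mathcal{A})$ be a two-sender unicast index coding problem with an eavesdropper, with fully-participated interactions (all existing interactions are fully-participated), and belonging to Case II-E, i.e. the interaction digraph $\mathcal{H}$ contains a directed cycle of length 3 through the vertices $1,2,\{1,2\}$, and for neither $i\in\{1,2\}$ do both edges $(i,\{1,2\})$ and $(\{1,2\},i)$ belong to $\mathcal{H}$. If weakly secure linear index codes exist for the single-sender problems $\mathcal{I}(\mathcal{D}_{\mathcal{T}},\mathcal{A}_{\mathcal{T}})$ for all non-empty $\mathcal{T}\subseteq\{1,2\}$, then the optimal codelength $l^*=l^*(\mathcal{I}(\mathcal{D},\mathcal{P},\mathcal{A}))$ satisfies $$l^*\le\max\{l^*_{\{1,2\}}+l^*_1,\ l^*_{\{1,2\}}+l^*_2,\ l^*_2+l^*_1\}.$$ The bound is attained by the following weakly secure linear two-sender index codes, where $\mathcal{C}_{\mathcal{T}}$ is an optimal weakly secure linear code for $\mathcal{I}(\mathcal{D}_{\mathcal{T}},\mathcal{A}_{\mathcal{T}})$: (i) If $l^*_1\le\min\{l^*_2,l^*_{\{1,2\}}\}$: $\mathcal{S}_1$ sends $\mathcal{C}_1+\mathcal{C}_{\{1,2\}}[1:l^*_1]$, $\mathcal{S}_2$ sends $\mathcal{C}_2+\mathcal{C}_{\{1,2\}}[1:l^*_1]$, and one of $\mathcal{S}_1$, $\mathcal{S}_2$ (either one) sends $\mathcal{C}_{\{1,2\}}[l^*_1+1:l^*_{\{1,2\}}]$. (ii) If $l^*_2\le\min\{l^*_1,l^*_{\{1,2\}}\}$: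 $\mathcal{S}_1$ sends $\mathcal{C}_1+\mathcal{C}_{\{1,2\}}[1:l^*_2]$, $\mathcal{S}_2$ sends $\mathcal{C}_2+\mathcal{C}_{\{1,2\}}[1:l^*_2]$, and one of $\mathcal{S}_1$, $\mathcal{S}_2$ (either one) sends $\mathcal{C}_{\{1,2\}}[l^*_2+1:l^*_{\{1,2\}}]$. (iii) Otherwise: $\mathcal{S}_1$ sends $\mathcal{C}_1+\mathcal{C}_{\{1,2\}}$ and $\mathcal{S}_2$ sends $\mathcal{C}_2+\mathcal{C}_{\{1,2\}}$.
   Context: Fix a finite field $\mathbb{F}_q$ and messages $\mathcal{M}=\{x_1,\dots,x_m\}$, $x_i\in\mathbb{F}_q$; $x_i$ is a realization of a random variable $X_i$, and the $X_i$ are independent and uniform on $\mathbb{F}_q$. There are $m$ receivers; receiver $i$ demands $x_i$ and has side-information $\mathcal{K}_i\subseteq\mathcal{M}\setminus\{x_i\}$. The side-information digraph $\mathcal{D}$ has vertices $v_1,\dots,v_m$ and an edge $(v_i,v_j)$ iff $x_j\in\mathcal{K}_i$. For $\mathcal{B}\subseteq[m]=\{1,\dots,m\}$ put $x_{\mathcal{B}}=\{x_i:i\in\mathcal{B}\}$. Single-sender problem $\mathcal{I}(\mathcal{D},\mathcal{A})$: one sender knows all messages and transmits $\mathbf{G}\mathbf{x}$, $\mathbf{G}\in\mathbb{F}_q^{l\times m}$, $\mathbf{x}=(x_1,\dots,x_m)^T$; this is a linear index code of length $l$ if every receiver $i$ can recover $x_i$ from $\mathbf{G}\mathbf{x}$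 and $\mathcal{K}_i$. An eavesdropper knows $x_{\mathcal{A}}$ and $\mathbf{G}\mathbf{x}$. The code is weakly secure if $H(X_i\mid\mathbf{G}\mathbf{X},X_{\mathcal{A}})=H(X_i)$ for every message index $i\notin\mathcal{A}$. Two-sender problem $\mathcal{I}(\mathcal{D},\mathcal{P},\mathcal{A})$: sender $\mathcal{S}_j$ knows $\mathcal{M}_j\subseteq\mathcal{M}$, $j\in\{1,2\}$, with $\mathcal{M}_1\cup\mathcal{M}_2=\mathcal{M}$. Put $\mathcal{P}_1=\mathcal{M}_1\setminus\mathcal{M}_2$, $\mathcal{P}_2=\mathcal{M}_2\setminus\mathcal{M}_1$, $\mathcal{P}_{\{1,2\}}=\mathcal{M}_1\cap\mathcal{M}_2$, $\mathcal{P}=(\mathcal{P}_1,\mathcal{P}_2,\mathcal{P}_{\{1,2\}})$. Singletons are written without braces: the non-empty $\mathcal{T}\subseteq\{1,2\}$ are $1,2,\{1,2\}$. A linear two-sender index code consists of linear codewords $\mathbf{c}_1,\mathbf{c}_2$ over $\mathbb{F}_q$ of lengths $l_1,l_2$, where $\mathbf{c}_j$ (everything sent by $\mathcal{S}_j$) is a linear function of the messages in $\mathcal{M}_j$ only, such that each receiver $i$ can recover $x_i$ from $\mathbf{c}_1,\mathbf{c}_2,\mathcal{K}_i$. Its length is $l_1+l_2$. An eavesdropper knows $x_{\mathcal{A}}$, $\mathcal{A}\subsetneq[m]$, and $\mathbf{c}_1,\mathbf{c}_2$; the code is weakly secure if $H(X_i\mid\mathbf{c}_1,\mathbf{c}_2,X_{\mathcal{A}})=H(X_i)$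 for all $i\in[m]\setminus\mathcal{A}$. For non-empty $\mathcal{T}\subseteq\{1,2\}$, $\mathcal{D}_{\mathcal{T}}$ is the sub-digraph of $\mathcal{D}$ induced by $\{v_j:x_j\in\mathcal{P}_{\mathcal{T}}\}$ (the problem with messages and receivers restricted to $\mathcal{P}_{\mathcal{T}}$, side-information $\mathcal{K}_i\cap\mathcal{P}_{\mathcal{T}}$), and $\mathcal{A}_{\mathcal{T}}$ is the set of $i\in\mathcal{A}$ with $x_i\in\mathcal{P}_{\mathcal{T}}$. $l^*(\cdot)$ denotes the minimum length over $\mathbb{F}_q$ of a weakly secure linear index code for the given problem, and $l^*_{\mathcal{T}}=l^*(\mathcal{I}(\mathcal{D}_{\mathcal{T}},\mathcal{A}_{\mathcal{T}}))$. For $\mathcal{T}\ne\mathcal{T}'$, the interaction $\mathcal{D}_{\mathcal{T}}\rightarrow\mathcal{D}_{\mathcal{T}'}$ exists if $\mathcal{D}$ has an edge from some vertex of $\mathcal{D}_{\mathcal{T}}$ to some vertex of $\mathcal{D}_{\mathcal{T}'}$; it is fully-participated if there are edges from every vertex of $\mathcal{D}_{\mathcal{T}}$ to every vertex of $\mathcal{D}_{\mathcal{T}'}$. The interaction digraph $\mathcal{H}$ has vertex set $\{1,2,\{1,2\}\}$ and an edge $(\mathcal{T},\mathcal{T}')$ iff the interaction $\mathcal{D}_{\mathcal{T}}\rightarrow\mathcal{D}_{\mathcal{T}'}$ exists. For two codewords, $\mathbf{c}+\mathbf{c}'$ denotes symbol-wise addition after appending zeros at the end of the shorter one to match the length of the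 longer one; $\mathbf{c}[a:b]$ is the vector of code symbols of $\mathbf{c}$ in coordinates $a$ through $b$ (empty if $a>b$). *)

(* Defs.v *)
From HB Require Import structures.
From mathcomp Require Import all_boot all_order all_algebra.
From mathcomp Require Import boolp reals exp.

Set Implicit Arguments.
Unset Strict Implicit.
Unset Printing Implicit Defensive.

Import GRing.Theory.
Local Open Scope ring_scope.

(* Finite random variables: [mu] is a probability mass function on a finite
   sample space [W], and a random variable is a function on [W].  Entropies are
   in nats; a change of base rescales both sides of H(X|Y) = H(X). *)
Section Entropy.
Variables (R : realType) (W : finType) (mu : W -> R).

Definition Pr (E : pred W) : R := \sum_(w | E w) mu w.

(* The convention 0 log 0 = 0 is built in, since the probability is a factor. *)
Definition entropy (S : finType) (X : W -> S) : R :=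
  - \sum_(s : S) Pr (fun w => X w == s) * ln (Pr (fun w => X w == s)).

Definition cond_pr (E E' : pred W) : R := Pr (fun w => E w && E' w) / Pr E'.

Definition cond_entropy (S U : finType) (X : W -> S) (Y : W -> U) : R :=
  \sum_(u : U) Pr (fun w => Y w == u) *
    (- \sum_(s : S) cond_pr (fun w => X w == s) (fun w => Y w == u) *
                    ln (cond_pr (fun w => X w == s) (fun w => Y w == u))).

End Entropy.

(* The minimum of a nonempty set of naturals; it takes the proof of
   nonemptiness as an argument, so that no default value is involved. *)
Lemma ex_asbool (Q : nat -> Prop) : (exists l, Q l) -> exists l, `[< Q l >].
Proof. by move=> [l Ql]; exists l; apply/asboolP. Qed.

Definition minimum (Q : nat -> Prop) (h : exists l, Q l) : nat :=
  ex_minn (ex_asbool h).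

Section Messages.
Variable F : finFieldType.

(* x_B, listed in increasing order of the indices *)
Definition sub_msg n (B : {set 'I_n}) (x : 'cV[F]_n) : 'cV[F]_#|B| :=
  \col_(k < #|B|) x (enum_val k) 0.

(* Joint law of independent messages, each uniform on [F]. *)
Definition uniform_law (R : realType) (a : F) : R := #|F|%:R^-1.

Definition message_law (R : realType) n (x : 'cV[F]_n) : R :=
  \prod_(i < n) uniform_law R (x i 0).

Definition recoverable n (i : 'I_n) (T : Type) (obs : 'cV[F]_n -> T) : Prop :=
  exists dec : T -> F, forall x : 'cV[F]_n, dec (obs x) = x i 0.

(* H(X_i | obs(X), X_A) = H(X_i) for all i outside A *)
Definition weakly_secure (R : realType) n (A : {set 'I_n}) (T : finType)
    (obs : 'cV[F]_n -> T) : Prop :=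
  forall i : 'I_n, i \notin A ->
    cond_entropy (@message_law R n) (fun x => x i 0)
                 (fun x => (obs x, sub_msg A x))
    = entropy (@message_law R n) (fun x => x i 0).

End Messages.

(* In the problems below, [K i] is the set of indices of the messages known to
   receiver [i], and the vertex v_i is identified with its index. *)
Definition side_digraph n (K : 'I_n -> {set 'I_n}) : rel 'I_n :=
  fun i j => j \in K i.

Section SingleSender.
Variables (R : realType) (F : finFieldType).

Definition index_code n (K : 'I_n -> {set 'I_n}) l (G : 'M[F]_(l, n)) : Prop :=
  forall i : 'I_n, recoverable i (fun x : 'cV[F]_n => (G *m x, sub_msg (K i) x)).

Definition secure_index_code n (K : 'I_n -> {set 'I_n}) (A : {set 'I_n})
    l (G : 'M[F]_(l, n)) : Prop :=
  index_code K G /\ weakly_secure R A (fun x : 'cV[F]_n => G *m x).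

Definition secure_length n (K : 'I_n -> {set 'I_n}) (A : {set 'I_n})
    (l : nat) : Prop :=
  exists G : 'M[F]_(l, n), secure_index_code K A G.

End SingleSender.

(* The problem induced by a set [B] of indices, renumbered by 'I_#|B| through
   the increasing enumeration [enum_val] of [B]. *)
Definition sub_side n (K : 'I_n -> {set 'I_n}) (B : {set 'I_n}) :
    'I_#|B| -> {set 'I_#|B|} :=
  fun k => [set j : 'I_#|B| | enum_val j \in K (enum_val k)].
Arguments sub_side {n} K B k.

Definition sub_adv n (A B : {set 'I_n}) : {set 'I_#|B|} :=
  [set j : 'I_#|B| | enum_val j \in A].

Section TwoSender.
Variables (R : realType) (F : finFieldType).

Definition linear_in n (B : {set 'I_n}) l (c : 'cV[F]_n -> 'cV[F]_l) : Prop :=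
  exists G : 'M[F]_(l, #|B|), forall x : 'cV[F]_n, c x = G *m sub_msg B x.

Definition two_sender_code n (K : 'I_n -> {set 'I_n}) (M1 M2 : {set 'I_n})
    l1 l2 (c1 : 'cV[F]_n -> 'cV[F]_l1) (c2 : 'cV[F]_n -> 'cV[F]_l2) : Prop :=
  [/\ linear_in M1 c1, linear_in M2 c2 &
      forall i : 'I_n, recoverable i (fun x => (c1 x, c2 x, sub_msg (K i) x))].

Definition secure_two_sender_code n (K : 'I_n -> {set 'I_n})
    (M1 M2 A : {set 'I_n}) l1 l2
    (c1 : 'cV[F]_n -> 'cV[F]_l1) (c2 : 'cV[F]_n -> 'cV[F]_l2) : Prop :=
  two_sender_code K M1 M2 c1 c2 /\ weakly_secure R A (fun x => (c1 x, c2 x)).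

Definition codelength n l1 l2
    (c1 : 'cV[F]_n -> 'cV[F]_l1) (c2 : 'cV[F]_n -> 'cV[F]_l2) : nat :=
  (l1 + l2)%N.

Definition two_sender_secure_length n (K : 'I_n -> {set 'I_n})
    (M1 M2 A : {set 'I_n}) (l : nat) : Prop :=
  exists (l1 l2 : nat)
         (c1 : 'cV[F]_n -> 'cV[F]_l1) (c2 : 'cV[F]_n -> 'cV[F]_l2),
    secure_two_sender_code K M1 M2 A c1 c2 /\ codelength c1 c2 = l.

End TwoSender.

(* The nonempty subsets 1, 2, {1,2} of the set of senders. *)
Variant senders := S1 | S2 | S12.

Definition senders_code (T : senders) : option bool :=
  match T with S1 => Some false | S2 => Some true | S12 => None end.
Definition senders_decode (o : option bool) : senders :=
  match o with Some false => S1 | Some true => S2 | None => S12 end.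
Lemma senders_codeK : cancel senders_code senders_decode.
Proof. by case. Qed.
HB.instance Definition _ := Equality.copy senders (can_type senders_codeK).

Definition part n (M1 M2 : {set 'I_n}) (T : senders) : {set 'I_n} :=
  match T with
  | S1 => M1 :\: M2
  | S2 => M2 :\: M1
  | S12 => M1 :&: M2
  end.

Section Interactions.
Variables (n : nat) (K : 'I_n -> {set 'I_n}) (M1 M2 : {set 'I_n}).

Definition interaction_digraph : rel senders := fun T T' =>
  (T != T') &&
  [exists i in part M1 M2 T, exists j in part M1 M2 T', side_digraph K i j].

Definition fully_participated : Prop :=
  forall T T' : senders, interaction_digraph T T' ->
    forall i j : 'I_n, i \in part M1 M2 T -> j \in part M1 M2 T' ->
      side_digraph K i j.

(* As [senders] has three elements, the cycle passes through all of them. *)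
Definition case_IIE : Prop :=
  (exists s : seq senders,
     [/\ size s = 3, uniq s & cycle interaction_digraph s]) /\
  (forall T : senders, T = S1 \/ T = S2 ->
     ~ (interaction_digraph T S12 /\ interaction_digraph S12 T)).

End Interactions.

Section Codewords.
Variable F : finFieldType.

(* Symbol of [u] in the 0-based coordinate [k], and 0 beyond the length. *)
Definition symbol l (u : 'cV[F]_l) (k : nat) : F :=
  if insub k is Some i then u i 0 else 0.

Definition pad_add l l' (u : 'cV[F]_l) (v : 'cV[F]_l') : 'cV[F]_(maxn l l') :=
  \col_(k < maxn l l') (symbol u k + symbol v k).

(* u[a:b], with 1-based inclusive bounds 1 <= a and b <= l. *)
Definition slice l (u : 'cV[F]_l) (a b : nat) : 'cV[F]_(b.+1 - a) :=
  \col_(k < b.+1 - a) symbol u (a.-1 + k).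

End Codewords.

(* Main.v *)
(* For a linear observation [G x], weak security at [i] means that some z with
   G z = 0 and z_A = 0 has z_i = 1: otherwise x_i is determined by (G x, x_A)
   and its conditional entropy is 0 rather than ln q.  Such a z, supported on
   one part of the messages, leaves the three codewords c1, c2, c12 unchanged,
   so every function of these codewords is weakly secure.
   All three constructions reveal c1 + c12[1:t], c2 + c12[1:t] and
   c12[t+1:l12] for t = l1, l2 or l12.  Along the 3-cycle each receiver knows
   one of c1, c2, c12 from its side-information, and solves for its own. *)

Require Import Defs.
From HB Require Import structures.
From mathcomp Require Import all_boot all_order all_algebra.
From mathcomp Require Import boolp reals exp.
From mathcomp Require Import zify.

Set Implicit Arguments.
Unset Strict Implicit.
Unset Printing Implicit Defensive.

Import GRing.Theory.
Local Open Scope ring_scope.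

(** * Entropy over an arbitrary finite sample space *)

Section FiniteProbability.
Variables (R : realType) (W : finType) (mu : W -> R).

Lemma eq_Pr (E E' : pred W) : E =1 E' -> Pr mu E = Pr mu E'.
Proof. exact: eq_bigl. Qed.

Lemma Pr_partition (S : finType) (X : W -> S) (E : pred W) :
  \sum_s Pr mu (fun w => (X w == s) && E w) = Pr mu E.
Proof.
rewrite /Pr [RHS](partition_big X predT) //=; apply: eq_bigr => s _.
by apply: eq_bigl => w; rewrite andbC.
Qed.

(** Given [Y = u], each conditional probability is 0 or 1, and [p * ln p] vanishes at both. *)
Lemma cond_entropy_determined (S U : finType) (X : W -> S) (Y : W -> U) :
  (forall w w', Y w = Y w' -> X w = X w') -> cond_entropy mu X Y = 0.
Proof.
move=> XY; apply: big1 => u _; rewrite big1 ?oppr0 ?mulr0 // => s _.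
set p := cond_pr _ _ _; suff [->|->] : p = 0 \/ p = 1.
- by rewrite mul0r.
- by rewrite ln1 mulr0.
have [/existsP[w /andP[/eqP Xw /eqP Yw]]|] :=
  boolP [exists w, (X w == s) && (Y w == u)].
- rewrite /p /cond_pr (@eq_Pr _ (fun w => Y w == u)); last first.
    move=> w' /=; case: (eqVneq (Y w') u) => [Yw'|_]; rewrite ?andbF // andbT.
    by apply/eqP; rewrite -Xw; apply: XY; rewrite Yw Yw'.
  have [->|p0] := eqVneq (Pr mu (fun w => Y w == u)) 0.
    by left; rewrite mul0r.
  by right; rewrite divff.
- rewrite negb_exists => /forallP N; left.
  by rewrite /p /cond_pr /Pr big_pred0 ?mul0r // => w; apply: negbTE.
Qed.

End FiniteProbability.

(** * Uniform messages and weak security *)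

Section UniformMessages.
Variables (R : realType) (F : finFieldType) (n : nat).
Local Notation q := (#|F|%:R : R).
Local Notation mu := (@message_law F R n).

Lemma card_finField_neq0 : q != 0.
Proof.
by rewrite Num.Theory.pnatr_eq0 -lt0n; apply/card_gt0P; exists 0.
Qed.

Lemma message_lawE x : mu x = q ^- n.
Proof. by rewrite /message_law /uniform_law prodr_const card_ord exprVn. Qed.

Lemma Pr_message_total : Pr mu predT = 1.
Proof.
rewrite /Pr (eq_bigr _ (fun x _ => message_lawE x)) sumr_const.
have -> : #|(predT : pred 'cV[F]_n)| = (#|F| ^ n)%N.
  by have := card_mx F n 1; rewrite muln1 => <-; apply: eq_card.
by rewrite -[LHS]mulr_natl natrX divff // expf_neq0 // card_finField_neq0.
Qed.

Lemma Pr_message_shift (E : pred 'cV[F]_n) z :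
  Pr mu (fun x => E (x + z)) = Pr mu E.
Proof.
rewrite /Pr [RHS](reindex_inj (addIr z)) /=.
by apply: eq_bigr => x _; rewrite !message_lawE.
Qed.

(** Translation by [t *: z] preserves the law and [E], and carries [x_i = 0] to [x_i = t]. Hence the
    [q] values of [x_i] split [E] into events of equal probability. *)
Lemma Pr_coord_invariant (i : 'I_n) (z : 'cV[F]_n) (E : pred 'cV[F]_n) s :
  z i 0 = 1 -> (forall a x, E (x + a *: z) = E x) ->
  Pr mu (fun x => (x i 0 == s) && E x) = q^-1 * Pr mu E.
Proof.
move=> zi Ez.
have P0 t : Pr mu (fun x => (x i 0 == t) && E x) =
            Pr mu (fun x => (x i 0 == 0) && E x).
  rewrite -(Pr_message_shift _ (t *: z)); apply: eq_Pr => x.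
  by rewrite Ez !mxE zi mulr1 -[X in _ == X]add0r (inj_eq (addIr t)).
rewrite -[Pr mu E](Pr_partition _ (fun x : 'cV[F]_n => x i 0)).
rewrite (eq_bigr _ (fun t _ => P0 t)) sumr_const P0 -[Pr _ _ *+ _]mulr_natl mulrA.
by rewrite mulVf ?card_finField_neq0 // mul1r.
Qed.

Lemma sum_uniform_ln : - (\sum_(s : F) q^-1 * ln q^-1) = ln q.
Proof.
rewrite sumr_const -[_ * _ *+ _]mulr_natl mulrA divff ?card_finField_neq0 // mul1r.
by rewrite lnV ?opprK // Num.Theory.posrE Num.Theory.lt0r
  card_finField_neq0 Num.Theory.ler0n.
Qed.

Lemma entropy_message (i : 'I_n) : entropy mu (fun x => x i 0) = ln q.
Proof.
rewrite -sum_uniform_ln /entropy; congr (- _); apply: eq_bigr => s _.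
suff -> : Pr mu (fun x => x i 0 == s) = q^-1 by [].
have := @Pr_coord_invariant i (delta_mx i 0) predT s.
rewrite Pr_message_total mulr1 mxE !eqxx => <- //.
by apply: eq_Pr => x; rewrite andbT.
Qed.

Lemma entropy_message_neq0 (i : 'I_n) : entropy mu (fun x => x i 0) != 0.
Proof.
rewrite entropy_message Num.Theory.lt0r_neq0 // ln_gt0 // Num.Theory.ltr1n.
exact: card_finNzRing_gt1.
Qed.

Lemma sub_msg_eqP (B : {set 'I_n}) (x y : 'cV[F]_n) :
  sub_msg B x = sub_msg B y <-> {in B, forall j, x j 0 = y j 0}.
Proof.
split=> [/colP xy j jB|xy].
  by have := xy (enum_rank_in jB j); rewrite !mxE enum_rankK_in.
by apply/colP => k; rewrite !mxE; apply: xy; apply: enum_valP.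
Qed.

(** [Pr_coord_invariant], applied to each fibre of [Y], makes [X_i] uniform given [Y]. Every inner
    entropy is then [ln q], weighted by probabilities of total 1. *)
Lemma cond_entropy_invariant (T : finType) (Y : 'cV[F]_n -> T) (i : 'I_n) (z : 'cV[F]_n) :
  z i 0 = 1 -> (forall a x, Y (x + a *: z) = Y x) ->
  cond_entropy mu (fun x => x i 0) Y = entropy mu (fun x => x i 0).
Proof.
move=> zi Yz; rewrite entropy_message -[RHS]mul1r -[X in X * ln _]Pr_message_total.
have -> : Pr mu predT = \sum_u Pr mu (fun x => Y x == u).
  rewrite -(Pr_partition _ Y predT); apply: eq_bigr => u _.
  by apply: eq_Pr => x; rewrite andbT.
rewrite mulr_suml; apply: eq_bigr => u _.
(* Fibres of probability 0 are set aside, as [cond_pr] divides by this probability. *)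
have [->|p0] := eqVneq (Pr mu (fun x => Y x == u)) 0; first by rewrite !mul0r.
congr (_ * _); rewrite -sum_uniform_ln; congr (- _); apply: eq_bigr => s _.
suff -> : cond_pr mu (fun x => x i 0 == s) (fun x => Y x == u) = q^-1 by [].
rewrite /cond_pr (@Pr_coord_invariant i z) ?mulfK // => a x.
by rewrite Yz.
Qed.

Lemma weakly_secure_kernel (A : {set 'I_n}) l (G : 'M[F]_(l, n)) i :
  weakly_secure R A (fun x => G *m x) -> i \notin A ->
  exists z : 'cV[F]_n,
    [/\ G *m z = 0, {in A, forall j, z j 0 = 0} & z i 0 = 1].
Proof.
move=> sec iA; have := sec i iA; apply: contra_eqP => /forallNP N.
rewrite cond_entropy_determined; first by rewrite eq_sym entropy_message_neq0.
move=> x y [/eqP Gxy /sub_msg_eqP xyA]; apply/eqP; rewrite -subr_eq0.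
(* Two message vectors with equal observations but different [i]-th entries would give the forbidden
   kernel vector: their difference, scaled to have [i]-th entry 1. *)
apply/negPn/negP => d0; apply: (N ((x i 0 - y i 0)^-1 *: (x - y))); split.
- by rewrite -scalemxAr mulmxBr (eqP Gxy) subrr scaler0.
- by move=> j /xyA xyj; rewrite !mxE xyj subrr mulr0.
- by rewrite !mxE mulVf.
Qed.

(** Converse of [weakly_secure_kernel], with invariance in place of a kernel so that it applies
    directly to a pair of codewords. *)
Lemma weakly_secure_of_invariant (A : {set 'I_n}) (T : finType)
    (obs : 'cV[F]_n -> T) :
  (forall i, i \notin A -> exists z : 'cV[F]_n,
     [/\ forall a x, obs (x + a *: z) = obs x,
         {in A, forall j, z j 0 = 0} & z i 0 = 1]) ->
  weakly_secure R A obs.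
Proof.
move=> H i /H[z [oz zA zi]]; apply: (cond_entropy_invariant zi) => a x.
congr pair; first exact: oz.
by apply/sub_msg_eqP => j jA; rewrite !mxE zA // mulr0 addr0.
Qed.

(** * Criteria for decodability and linearity *)

Lemma recoverableP (i : 'I_n) (T : Type) (obs : 'cV[F]_n -> T) :
  recoverable i obs <-> (forall x y, obs x = obs y -> x i 0 = y i 0).
Proof.
split=> [[dec decE] x y xy|H]; first by rewrite -!decE xy.
(* The decoder reads [x_i] off any message vector consistent with the observation; the value 0 is
   only taken outside the range of [obs]. *)
exists (fun t => if [pick x | `[< obs x = t >]] is Some x then x i 0 else 0).
move=> x; case: pickP => [y /asboolP/H //|/(_ x)/asboolP].
by case.
Qed.

(** Coefficients are indexed by all of ['I_n], which avoids the renumbering of [B] by [enum_val]. *)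
Definition linear_form (B : {set 'I_n}) (f : 'cV[F]_n -> F) : Prop :=
  exists g : 'I_n -> F, forall x, f x = \sum_(j in B) g j * x j 0.

Lemma linear_formD B f g : linear_form B f -> linear_form B g ->
  linear_form B (fun x => f x + g x).
Proof.
move=> [f' fE] [g' gE]; exists (fun j => f' j + g' j) => x.
by rewrite fE gE -big_split; apply: eq_bigr => j _; rewrite mulrDl.
Qed.

Lemma linear_form0 B : linear_form B (fun=> 0).
Proof. by exists (fun=> 0) => x; rewrite big1 // => j _; rewrite mul0r. Qed.

Lemma linear_inP B l (c : 'cV[F]_n -> 'cV[F]_l) :
  linear_in B c <-> forall k, linear_form B (fun x => c x k 0).
Proof.
split=> [[G cE] k|/choice[g gE]].
  (* This sum inverts [enum_val]: it has one term for [j] in [B] and none otherwise. *)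
  exists (fun j => \sum_(h | enum_val h == j) G k h) => x.
  rewrite cE mxE [RHS]big_enum_val; apply: eq_bigr => h _; rewrite mxE; congr (_ * _).
  by rewrite (big_pred1 h) // => h'; rewrite (inj_eq enum_val_inj).
exists (\matrix_(k, h) g k (enum_val h)) => x; apply/colP => k.
rewrite gE mxE [LHS]big_enum_val; apply: eq_bigr => h _.
by rewrite !mxE.
Qed.

(** Coefficients extend by zero; this lets a sender transmit the code of any part it knows. *)
Lemma linear_in_sub (B B' : {set 'I_n}) l (G : 'M[F]_(l, #|B|)) : B \subset B' ->
  linear_in B' (fun x => G *m sub_msg B x).
Proof.
move=> sBB'; apply/linear_inP => k.
have /linear_inP/(_ k)[g gE] : linear_in B (fun x : 'cV[F]_n => G *m sub_msg B x).
  by exists G.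
exists (fun j => if j \in B then g j else 0) => x; rewrite gE.
rewrite [RHS](bigID [in B]) /= [X in _ + X]big1 ?addr0; last first.
  by move=> j /andP[_ /negbTE->]; rewrite mul0r.
apply: eq_big => [j|j ->//].
by case: (boolP (j \in B)) => [/(subsetP sBB')->|]; rewrite ?andbF.
Qed.

End UniformMessages.

(** * Symbols of padded, sliced and stacked codewords *)

Section Symbols.
Variable F : finFieldType.

Lemma symbol_ord l (u : 'cV[F]_l) (k : 'I_l) : symbol u k = u k 0.
Proof. by rewrite /symbol valK. Qed.

Lemma symbol_ge l (u : 'cV[F]_l) k : (l <= k)%N -> symbol u k = 0.
Proof. by move=> lk; rewrite /symbol insubN // -leqNgt. Qed.

(** Comparing symbols at natural indices keeps dependent lengths such as [maxn l l'] out of later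
    arguments. *)
Lemma symbol_inj l (u v : 'cV[F]_l) :
  (forall k, symbol u k = symbol v k) -> u = v.
Proof. by move=> uv; apply/colP => k; rewrite -!symbol_ord. Qed.

Lemma symbol_pad_add l l' (u : 'cV[F]_l) (v : 'cV[F]_l') k :
  symbol (pad_add u v) k = symbol u k + symbol v k.
Proof.
have [lk|kl] := leqP (maxn l l') k.
  have := lk; rewrite geq_max => /andP[ul vl].
  by rewrite !symbol_ge // addr0.
by rewrite -[k]/(val (Ordinal kl)) symbol_ord mxE.
Qed.

Lemma symbol_slice l (u : 'cV[F]_l) a b k :
  symbol (slice u a b) k = if (k < b.+1 - a)%N then symbol u (a.-1 + k) else 0.
Proof.
have [kl|lk] := ltnP; last by rewrite symbol_ge.
by rewrite -[k in LHS]/(val (Ordinal kl)) symbol_ord mxE.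
Qed.

Lemma symbol_slice1 l (u : 'cV[F]_l) t k :
  symbol (slice u 1 t) k = if (k < t)%N then symbol u k else 0.
Proof. by rewrite symbol_slice subn1. Qed.

Section LinearIn.
Variables (n : nat) (B : {set 'I_n}).

Lemma linear_form_symbol l (c : 'cV[F]_n -> 'cV[F]_l) k :
  linear_in B c -> linear_form B (fun x => symbol (c x) k).
Proof.
move=> /linear_inP lc; rewrite /symbol; case: insub => [j|]; first exact: lc.
exact: linear_form0.
Qed.

Lemma linear_in_pad_add l l' (c : 'cV[F]_n -> 'cV[F]_l)
    (c' : 'cV[F]_n -> 'cV[F]_l') :
  linear_in B c -> linear_in B c' -> linear_in B (fun x => pad_add (c x) (c' x)).
Proof.
move=> lc lc'; apply/linear_inP => k.
have [g gE] := linear_formD (linear_form_symbol k lc) (linear_form_symbol k lc').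
by exists g => x; rewrite mxE gE.
Qed.

Lemma linear_in_slice l (c : 'cV[F]_n -> 'cV[F]_l) a b :
  linear_in B c -> linear_in B (fun x => slice (c x) a b).
Proof.
move=> lc; apply/linear_inP => k.
have [g gE] := linear_form_symbol (a.-1 + k) lc.
by exists g => x; rewrite mxE gE.
Qed.

Lemma linear_in_col_mx l l' (c : 'cV[F]_n -> 'cV[F]_l)
    (c' : 'cV[F]_n -> 'cV[F]_l') :
  linear_in B c -> linear_in B c' -> linear_in B (fun x => col_mx (c x) (c' x)).
Proof.
move=> [G cE] [G' c'E]; exists (col_mx G G') => x.
by rewrite mul_col_mx cE c'E.
Qed.

End LinearIn.
End Symbols.

(** * Extension by zero from one part to all messages *)

Definition zero_extend (F : finFieldType) n (B : {set 'I_n})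
    (z : 'cV[F]_#|B|) : 'cV[F]_n :=
  \col_j (if [pick k | enum_val k == j] is Some k then z k 0 else 0).

Lemma zero_extend_in (F : finFieldType) n (B : {set 'I_n}) (z : 'cV[F]_#|B|) k :
  zero_extend z (enum_val k) 0 = z k 0.
Proof.
rewrite mxE; case: pickP => [k' /eqP/enum_val_inj->//|/(_ k)].
by rewrite eqxx.
Qed.

Lemma zero_extend_out (F : finFieldType) n (B : {set 'I_n}) (z : 'cV[F]_#|B|) j :
  j \notin B -> zero_extend z j 0 = 0.
Proof.
move=> jB; rewrite mxE; case: pickP => // k /eqP kj.
by rewrite -kj enum_valP in jB.
Qed.

(** * Decoding and security inherited from the codes of the parts *)

Section PartCodes.
Variables (R : realType) (F : finFieldType) (n : nat).
Variables (K : 'I_n -> {set 'I_n}) (M1 M2 A : {set 'I_n}).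
Hypothesis hM : M1 :|: M2 = [set: 'I_n].

Lemma in_some_part i : exists T, i \in part M1 M2 T.
Proof.
have : i \in M1 :|: M2 by rewrite hM inE.
rewrite inE; case: (boolP (i \in M1)) => i1; case: (boolP (i \in M2)) => i2 //= _.
- by exists S12; rewrite inE i1 i2.
- by exists S1; rewrite inE i1 i2.
- by exists S2; rewrite inE i1 i2.
Qed.

Lemma part_inj i T T' : i \in part M1 M2 T -> i \in part M1 M2 T' -> T = T'.
Proof.
by case: T; case: T' => //; rewrite !inE; case: (i \in M1); case: (i \in M2).
Qed.

Variables (l : senders -> nat) (C : forall T, 'M[F]_(l T, #|part M1 M2 T|)).
Hypothesis hC : forall T,
  secure_index_code R (sub_side K (part M1 M2 T)) (sub_adv A (part M1 M2 T)) (C T).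
Let c T (x : 'cV[F]_n) : 'cV[F]_(l T) := C T *m sub_msg (part M1 M2 T) x.

(** The side-information of the restricted problem is contained in [K i], so the decoder of [C T]
    still applies. *)
Lemma part_code_recover T i (x y : 'cV[F]_n) : i \in part M1 M2 T ->
  c T x = c T y -> {in K i, forall j, x j 0 = y j 0} -> x i 0 = y i 0.
Proof.
move=> iT cxy Kxy; have [/(_ (enum_rank_in iT i))/recoverableP rec _] := hC T.
have := rec (sub_msg _ x) (sub_msg _ y); rewrite !mxE enum_rankK_in //; apply.
congr pair; first exact: cxy.
by apply/sub_msg_eqP => k; rewrite !mxE inE enum_rankK_in // => /Kxy.
Qed.

Lemma part_code_direction i : i \notin A -> exists z : 'cV[F]_n,
  [/\ forall T a x, c T (x + a *: z) = c T x,
      {in A, forall j, z j 0 = 0} & z i 0 = 1].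
Proof.
move=> iA; have [T iT] := in_some_part i; have [_ sec] := hC T.
have kA : enum_rank_in iT i \notin sub_adv A (part M1 M2 T).
  by rewrite inE enum_rankK_in.
have [z [Gz zA zi]] := weakly_secure_kernel sec kA.
exists (zero_extend z); split=> [T' a x|j jA|].
- rewrite /c; have -> : sub_msg (part M1 M2 T') (x + a *: zero_extend z) =
      sub_msg (part M1 M2 T') x + a *: sub_msg (part M1 M2 T') (zero_extend z).
    by apply/colP => k; rewrite !mxE.
  rewrite mulmxDr -scalemxAr.
  suff -> : C T' *m sub_msg (part M1 M2 T') (zero_extend z) = 0.
    by rewrite scaler0 addr0.
  (* On the part of [i] this is [G z = 0]; the other parts are disjoint from it, so [zero_extend z]
     vanishes there. *)
  have [TT'|nTT'] := eqVneq T T'.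
    subst T'; rewrite -[RHS]Gz; congr (_ *m _); apply/colP => k.
    by rewrite [LHS]mxE zero_extend_in.
  rewrite (_ : sub_msg _ _ = 0) ?mulmx0 //; apply/colP => k.
  rewrite [LHS]mxE zero_extend_out ?mxE //; apply: contra nTT' => kT.
  by apply/eqP; apply: part_inj kT _; apply: enum_valP.
- have [jT|jT] := boolP (j \in part M1 M2 T); last exact: zero_extend_out.
  rewrite -(enum_rankK_in jT jT) zero_extend_in; apply: zA.
  by rewrite inE enum_rankK_in.
- by rewrite -[X in zero_extend _ X](enum_rankK_in iT iT) zero_extend_in.
Qed.

(** * Recovery along the 3-cycle *)

Hypothesis hfull : fully_participated K M1 M2.
Hypothesis hcase : case_IIE K M1 M2.

(** Up to rotation, three vertices admit only two cyclic orders. *)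
Lemma case_IIE_cycle :
  let H := interaction_digraph K M1 M2 in
  [/\ H S1 S2, H S2 S12 & H S12 S1] \/ [/\ H S1 S12, H S12 S2 & H S2 S1].
Proof.
move=> H; case: hcase => [[s [sz us cs]] _]; move: us cs.
case: s sz => [|a [|b [|d [|? ?]]]] //= _.
rewrite !inE -/H; case: a; case: b; case: d => // _ /and4P[? ? ? _];
  by [left; split | right; split].
Qed.

(** Full participation puts every message of part [T'] in the side-information of receiver [i],
    which can thus compute [c T'] itself. *)
Lemma interaction_code_eq T T' i (x y : 'cV[F]_n) :
  interaction_digraph K M1 M2 T T' -> i \in part M1 M2 T ->
  {in K i, forall j, x j 0 = y j 0} -> c T' x = c T' y.
Proof.
move=> TT' iT Kxy; congr (_ *m _); apply/sub_msg_eqP => j jT'.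
by apply: Kxy; apply: hfull TT' _ _ iT jT'.
Qed.

(** The 0-based symbol [k] of [c T + c12[1:t]]. *)
Let low_sum t T x k :=
  symbol (c T x) k + (if (k < t)%N then symbol (c S12 x) k else 0).

(* Whichever of c1, c2, c12 is known, peeling it off the sums yields the other
   two; no condition on [t] is needed. *)
Lemma cycle_recover t i (x y : 'cV[F]_n) :
  (forall k, low_sum t S1 x k = low_sum t S1 y k) ->
  (forall k, low_sum t S2 x k = low_sum t S2 y k) ->
  (forall k, (t <= k)%N -> symbol (c S12 x) k = symbol (c S12 y) k) ->
  {in K i, forall j, x j 0 = y j 0} -> x i 0 = y i 0.
Proof.
rewrite /low_sum => e1 e2 e12 Kxy; have [T iT] := in_some_part i.
have known T' : interaction_digraph K M1 M2 T T' -> c T' x = c T' y.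
  by move=> TT'; apply: interaction_code_eq TT' iT Kxy.
apply: (part_code_recover iT) Kxy.
have low T' : T' != S12 -> c T' x = c T' y ->
    forall k, (k < t)%N -> symbol (c S12 x) k = symbol (c S12 y) k.
  move=> T'12 cT' k kt.
  by case: T' T'12 cT' => // _ cT'; [move: (e1 k)|move: (e2 k)];
    rewrite kt cT' => /addrI.
(* The first [t] symbols of [c12] come from a sum, the others from [e12]. *)
have to12 T' : T' != S12 -> c T' x = c T' y -> c S12 x = c S12 y.
  move=> T'12 /(low _ T'12) lowT'; apply: symbol_inj => k.
  by case: (ltnP k t) => [/lowT'|/e12].
have from12 T' : c S12 x = c S12 y -> c T' x = c T' y.
  by move=> c12; case: T' => //; apply: symbol_inj => k;
    [move: (e1 k)|move: (e2 k)]; rewrite c12 => /addIr.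
(* A receiver in [T] knows the codeword of the successor of [T]. One step suffices when [T] or its
   successor is [S12]; otherwise [c12] is recovered on the way. *)
have [[H1 H2 H3]|[H1 H2 H3]] := case_IIE_cycle; case: T {iT} known => known.
- exact: from12 (to12 S2 isT (known _ H1)).
- exact: from12 (known _ H2).
- exact: to12 S1 isT (known _ H3).
- exact: from12 (known _ H1).
- exact: from12 (to12 S1 isT (known _ H3)).
- exact: to12 S2 isT (known _ H2).
Qed.

(** Common to all constructions: decoding holds because the transmission determines the sums and the
    tail of [c12], security because it is determined by the three part codewords. *)
Lemma secure_two_sender_of_sums t l1 l2
    (d1 : 'cV[F]_n -> 'cV[F]_l1) (d2 : 'cV[F]_n -> 'cV[F]_l2) :
  linear_in M1 d1 -> linear_in M2 d2 ->
  (forall x y, d1 x = d1 y -> d2 x = d2 y ->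
    [/\ forall k, low_sum t S1 x k = low_sum t S1 y k,
        forall k, low_sum t S2 x k = low_sum t S2 y k &
        forall k, (t <= k)%N -> symbol (c S12 x) k = symbol (c S12 y) k]) ->
  (forall x y, (forall T, c T x = c T y) -> d1 x = d1 y /\ d2 x = d2 y) ->
  secure_two_sender_code R K M1 M2 A d1 d2.
Proof.
move=> lin1 lin2 sums fromc; split; first split=> // i.
  apply/recoverableP => x y [d1xy d2xy /sub_msg_eqP Kxy].
  have [e1 e2 e12] := sums x y d1xy d2xy.
  exact: cycle_recover e1 e2 e12 Kxy.
apply: weakly_secure_of_invariant => i /part_code_direction[z [cz zA zi]].
exists z; split=> // a x.
by have [|-> ->] := fromc (x + a *: z) x.
Qed.

Lemma linear_in_part T :
  (T != S2 -> linear_in M1 (c T)) /\ (T != S1 -> linear_in M2 (c T)).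
Proof.
split; case: T => // _; apply: linear_in_sub;
  by [exact: subsetDl | exact: subsetIl | exact: subsetIr].
Qed.

(** * The transmitted codewords *)

Let low_code t T x := pad_add (c T x) (slice (c S12 x) 1 t).
(** The 1-based start [t.+1] is the 0-based coordinate [t]; the slice is empty once [l S12 <= t]. *)
Let high_code t x := slice (c S12 x) t.+1 (l S12).

Lemma low_codeP t T x y : low_code t T x = low_code t T y <->
  (forall k, low_sum t T x k = low_sum t T y k).
Proof.
have symE z k : symbol (low_code t T z) k = low_sum t T z k.
  by rewrite symbol_pad_add symbol_slice1.
split=> [xy k|xy]; first by rewrite -!symE xy.
by apply: symbol_inj => k; rewrite !symE.
Qed.

Lemma high_codeP t x y : high_code t x = high_code t y ->
  forall k, (t <= k)%N -> symbol (c S12 x) k = symbol (c S12 y) k.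
Proof.
move=> xy k tk; have [kl|lk] := ltnP k (l S12); last by rewrite !symbol_ge.
have := congr1 (fun u => symbol u (k - t)) xy.
by rewrite !symbol_slice subSS ltn_sub2r ?subnKC //; apply: leq_ltn_trans kl.
Qed.

Lemma linear_in_low_code t :
  linear_in M1 (low_code t S1) /\ linear_in M2 (low_code t S2).
Proof.
have [[lin1 _] [_ lin2] [lin12 lin12']] :=
  And3 (linear_in_part S1) (linear_in_part S2) (linear_in_part S12).
by split; apply: linear_in_pad_add; auto; apply: linear_in_slice; auto.
Qed.

Lemma linear_in_high_code t :
  linear_in M1 (high_code t) /\ linear_in M2 (high_code t).
Proof.
have [lin12 lin12'] := linear_in_part S12.
by split; apply: linear_in_slice; auto.
Qed.

(** Serves (i) and (ii) together: [t] becomes [l S1] or [l S2] only when lengths are computed. *)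
Lemma secure_high_code_by_sender1 t : secure_two_sender_code R K M1 M2 A
  (fun x => col_mx (low_code t S1 x) (high_code t x)) (low_code t S2).
Proof.
have [lin1 lin2] := linear_in_low_code t; have [hin1 _] := linear_in_high_code t.
apply: (@secure_two_sender_of_sums t) => //; first exact: linear_in_col_mx.
  move=> x y /eq_col_mx[xy1 xyh] xy2.
  by split; [apply/low_codeP|apply/low_codeP|apply: high_codeP].
by move=> x y xy; rewrite /low_code /high_code !xy.
Qed.

Lemma secure_high_code_by_sender2 t : secure_two_sender_code R K M1 M2 A
  (low_code t S1) (fun x => col_mx (low_code t S2 x) (high_code t x)).
Proof.
have [lin1 lin2] := linear_in_low_code t; have [_ hin2] := linear_in_high_code t.
apply: (@secure_two_sender_of_sums t) => //; first exact: linear_in_col_mx.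
  move=> x y xy1 /eq_col_mx[xy2 xyh].
  by split; [apply/low_codeP|apply/low_codeP|apply: high_codeP].
by move=> x y xy; rewrite /low_code /high_code !xy.
Qed.

(** This is the case [t = l S12]: truncating [c12] at its own length changes nothing and leaves no
    tail to send. *)
Lemma secure_full_sums : secure_two_sender_code R K M1 M2 A
  (fun x => pad_add (c S1 x) (c S12 x)) (fun x => pad_add (c S2 x) (c S12 x)).
Proof.
have [[lin1 _] [_ lin2] [lin12 lin12']] :=
  And3 (linear_in_part S1) (linear_in_part S2) (linear_in_part S12).
have symE T z k : symbol (pad_add (c T z) (c S12 z)) k = low_sum (l S12) T z k.
  rewrite symbol_pad_add /low_sum; case: ltnP => // lk.
  by rewrite [X in _ + X]symbol_ge.
apply: (@secure_two_sender_of_sums (l S12)).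
- by apply: linear_in_pad_add; auto.
- by apply: linear_in_pad_add; auto.
- move=> x y xy1 xy2; split=> k; first by rewrite -!symE xy1.
    by rewrite -!symE xy2.
  by move=> lk; rewrite !symbol_ge.
- by move=> x y xy; rewrite !xy.
Qed.

End PartCodes.

(** * The bound and the codes attaining it *)

Theorem corollary4 (R : realType) (F : finFieldType) (m : nat)
    (K : 'I_m -> {set 'I_m}) (M1 M2 A : {set 'I_m})
    (hK : forall i : 'I_m, i \notin K i)
    (hM : M1 :|: M2 = [set: 'I_m])
    (hA : A \proper [set: 'I_m])
    (hfull : fully_participated K M1 M2)
    (hcase : case_IIE K M1 M2)
    (hexist : forall T : senders, exists l : nat,
        secure_length R F (sub_side K (part M1 M2 T))
                          (sub_adv A (part M1 M2 T)) l) :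
  let l (T : senders) : nat := minimum (hexist T) in
  let bound : nat :=
    (maxn (maxn (l S12 + l S1) (l S12 + l S2)) (l S2 + l S1))%N in
  let attains (l1 l2 : nat)
      (c1 : 'cV[F]_m -> 'cV[F]_l1) (c2 : 'cV[F]_m -> 'cV[F]_l2) : Prop :=
    secure_two_sender_code R K M1 M2 A c1 c2 /\ codelength c1 c2 = bound in
  (exists h : exists l' : nat, two_sender_secure_length R F K M1 M2 A l',
      (minimum h <= bound)%N)
  /\
  (forall C : forall T : senders, 'M[F]_(l T, #|part M1 M2 T|),
     (forall T : senders,
        secure_index_code R (sub_side K (part M1 M2 T))
                            (sub_adv A (part M1 M2 T)) (C T)) ->
     let c (T : senders) (x : 'cV[F]_m) : 'cV[F]_(l T) :=
       C T *m sub_msg (part M1 M2 T) x in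
     let case1 : Prop := (l S1 <= minn (l S2) (l S12))%N in
     let case2 : Prop := (l S2 <= minn (l S1) (l S12))%N in
     [/\ case1 ->
           attains _ _
             (fun x => col_mx (pad_add (c S1 x) (slice (c S12 x) 1 (l S1)))
                              (slice (c S12 x) (l S1).+1 (l S12)))
             (fun x => pad_add (c S2 x) (slice (c S12 x) 1 (l S1)))
           /\
           attains _ _
             (fun x => pad_add (c S1 x) (slice (c S12 x) 1 (l S1)))
             (fun x => col_mx (pad_add (c S2 x) (slice (c S12 x) 1 (l S1)))
                              (slice (c S12 x) (l S1).+1 (l S12))),
         case2 ->
           attains _ _
             (fun x => col_mx (pad_add (c S1 x) (slice (c S12 x) 1 (l S2)))
                              (slice (c S12 x) (l S2).+1 (l S12)))
             (fun x => pad_add (c S2 x) (slice (c S12 x) 1 (l S2)))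
           /\
           attains _ _
             (fun x => pad_add (c S1 x) (slice (c S12 x) 1 (l S2)))
             (fun x => col_mx (pad_add (c S2 x) (slice (c S12 x) 1 (l S2)))
                              (slice (c S12 x) (l S2).+1 (l S12)))
       & ~ case1 -> ~ case2 ->
           attains _ _
             (fun x => pad_add (c S1 x) (c S12 x))
             (fun x => pad_add (c S2 x) (c S12 x))]).
Proof.
move=> l bound attains.
have attained (C : forall T, 'M[F]_(l T, #|part M1 M2 T|)) :
    (forall T : senders, secure_index_code R (sub_side K (part M1 M2 T))
                            (sub_adv A (part M1 M2 T)) (C T)) -> _ :=
  fun hC => And3
    (fun t => secure_high_code_by_sender1 hM hC hfull hcase t)
    (fun t => secure_high_code_by_sender2 hM hC hfull hcase t)
    (secure_full_sums hM hC hfull hcase).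
split; last first.
  move=> C /attained[code1 code2 code3] c case1 case2; split.
  - rewrite /case1 leq_min => /andP[l12 l1_12].
    (* With [l S1] smallest, the lengths [l S1], [l S12 - l S1] and [l S2] add up to [l S12 + l S2],
       the largest of the three sums. *)
    by split; (split; [exact: code1 || exact: code2 | rewrite /codelength /bound; lia]).
  - rewrite /case2 leq_min => /andP[l21 l2_12].
    by split; (split; [exact: code1 || exact: code2 | rewrite /codelength /bound; lia]).
  - move=> n1 n2; split; first exact: code3.
    (* Failure of both cases forces [l S12] below [l S1] and [l S2], so the length is [l S1 + l S2],
       again the maximum. *)
    by rewrite /codelength /bound; move: n1 n2; rewrite /case1 /case2; lia.
have optimal T : exists C : 'M[F]_(l T, #|part M1 M2 T|),
    secure_index_code R (sub_side K (part M1 M2 T)) (sub_adv A (part M1 M2 T)) C.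
  by rewrite /l /minimum; case: ex_minnP => k /asboolP.
(* [cid] selects an optimal code for each part from mere existence. *)
pose C T := projT1 (cid (optimal T)).
have {}/attained[code1 code2 code3] := fun T => projT2 (cid (optimal T)) :
  secure_index_code R (sub_side K (part M1 M2 T)) (sub_adv A (part M1 M2 T)) (C T).
have bound_length : two_sender_secure_length R F K M1 M2 A bound.
  have [c1|c1] := boolP (l S1 <= minn (l S2) (l S12))%N.
    do 4!eexists; split; first exact: (code1 (l S1)).
    by rewrite /codelength /bound; lia.
  have [c2|c2] := boolP (l S2 <= minn (l S1) (l S12))%N.
    do 4!eexists; split; first exact: (code1 (l S2)).
    by rewrite /codelength /bound; lia.
  do 4!eexists; split; first exact: code3.
  by rewrite /codelength /bound; lia.
(* The code of length [bound] both witnesses nonemptiness and bounds the minimum. *)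
exists (ex_intro _ bound bound_length).
rewrite /minimum; case: ex_minnP => k _; apply; exact/asboolP.
Qed.
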